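(* There is an online algorithm with competitive ratio at most $95$ for the submodular matroid secretary problem on transversal matroids. That is, for every bipartite graph $G=(L,R,E)$ and every non-negative, monotonically non-decreasing submodular $f':2^L\to\mathbb{R}_{\ge0}$, the algorithm accepts a set $\mathrm{ALG}\subseteq L$ that is independent in the transversal matroid of $G$ and satisfies $\mathbb{E}[f'(\mathrm{ALG})]\ge\frac{1}{95}\max\{f'(T): T \text{ independent}\}$.
   Context: Transversal matroid: for a bipartite graph $G=(L,R,E)$, the ground set is $L$ and $T\subseteq L$ is independent if there is a matching in $G$ whose set of left endpoints is exactly $T$. Online model: the right side $R$ is known in advance; the nodes of $L$ arrive one at a time in uniformly random order, and when $\ell\in L$ arrives its incident edges are revealed. An adversary fixes a non-negative, monotonically non-decreasing submodular $f'$ on subsets of $L$ ($f'(S)+f'(T)\ge f'(S\cup T)+f'(S\cap T)$), which the algorithm can query only on sets of already-arrived nodes. On arrival of a node the algorithm must immediately and irrevocably accept it or not, keeping the accepted set independent. Competitive ratio at most $C$ means $\mathbb{E}[f'(\mathrm{ALG})]\ge\frac1C$ times the optimum over independent sets, for every $f'$, expectation over the random order and internal randomness. *)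

(* Defs.v *)
From HB Require Import structures.
From mathcomp Require Import all_boot all_order all_algebra all_fingroup.
From mathcomp Require Import reals.
Set Implicit Arguments. Unset Strict Implicit. Unset Printing Implicit Defensive.
Import Order.TTheory GRing.Theory Num.Theory.
Local Open Scope ring_scope.

(* Bipartite graph G = (L, R, E) with L = 'I_n, R = 'I_m, and edge set E given
   by adjacency: r \in adj l  <->  (l, r) \in E. *)

Definition is_matching (n m : nat) (adj : 'I_n -> {set 'I_m})
    (M : {set 'I_n * 'I_m}) : bool :=
  [forall e in M, e.2 \in adj e.1] &&
  [forall e in M, forall e' in M, ((e.1 == e'.1) || (e.2 == e'.2)) ==> (e == e')].

Definition transversal_indep (n m : nat) (adj : 'I_n -> {set 'I_m})
    (T : {set 'I_n}) : bool :=
  [exists M : {set 'I_n * 'I_m}, is_matching adj M && (T == [set e.1 | e in M])].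

Definition set_nonneg (R : realType) (n : nat) (f : {set 'I_n} -> R) :=
  forall S, 0 <= f S.
Definition set_monotone (R : realType) (n : nat) (f : {set 'I_n} -> R) :=
  forall S T : {set 'I_n}, S \subset T -> f S <= f T.
Definition set_submodular (R : realType) (n : nat) (f : {set 'I_n} -> R) :=
  forall S T : {set 'I_n}, f (S :|: T) + f (S :&: T) <= f S + f T.

(* Optimum value over independent sets (f >= 0 and set0 is independent). *)
Definition opt_value (R : realType) (n m : nat) (adj : 'I_n -> {set 'I_m})
    (f : {set 'I_n} -> R) : R :=
  \big[Num.max/0]_(T : {set 'I_n} | transversal_indep adj T) f T.

(* An online (randomized) algorithm, in behavioural form.  At step t (0-based),
   after the (t+1)-th node has arrived, it knows: n = |L|, m = |R| (R is known
   in advance), the arrived nodes (indexed by arrival position 'I_t.+1) with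
   their incident edges, the value oracle f' restricted to subsets of arrived
   nodes, and its own past decisions.  It returns the probability with which it
   accepts the current node (its internal randomness). *)
Definition online_alg (R : realType) :=
  forall (n m t : nat), ('I_t.+1 -> {set 'I_m}) -> ({set 'I_t.+1} -> R) ->
    ('I_t -> bool) -> R.

Definition valid_alg (R : realType) (A : online_alg R) :=
  forall n m t (a : 'I_t.+1 -> {set 'I_m}) (g : {set 'I_t.+1} -> R)
    (d : 'I_t -> bool), 0 <= @A n m t a g d <= 1.

Section Run.
Variables (R : realType) (A : online_alg R) (n m : nat).
Variables (adj : 'I_n -> {set 'I_m}) (f : {set 'I_n} -> R).

(* sigma t = the node of L arriving at time t. *)
Definition arrived (sigma : 'S_n) (t : 'I_n) (i : 'I_t.+1) : 'I_n :=
  sigma (widen_ord (ltn_ord t) i).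
Arguments arrived sigma t i : clear implicits.

Definition past (d : {ffun 'I_n -> bool}) (t : 'I_n) (i : 'I_t) : bool :=
  d (widen_ord (ltnW (ltn_ord t)) i).
Arguments past d t i : clear implicits.

Definition accept_prob (sigma : 'S_n) (d : {ffun 'I_n -> bool}) (t : 'I_n) : R :=
  @A n m t (fun i => adj (arrived sigma t i))
          (fun S => f (arrived sigma t @: S))
          (past d t).

Definition run_prob (sigma : 'S_n) (d : {ffun 'I_n -> bool}) : R :=
  \prod_(t < n) (if d t then accept_prob sigma d t else 1 - accept_prob sigma d t).

Definition accepted (sigma : 'S_n) (d : {ffun 'I_n -> bool}) : {set 'I_n} :=
  sigma @: [set t | d t].

Definition expected_value : R :=
  (n`!%:R)^-1 * \sum_(sigma : 'S_n) \sum_(d : {ffun 'I_n -> bool})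
     run_prob sigma d * f (accepted sigma d).
End Run.

(* Main.v *)
Require Import Defs.
From HB Require Import structures.
From mathcomp Require Import all_boot all_order all_algebra all_fingroup.
From mathcomp Require Import reals.
From mathcomp Require Import boolp zify lra.
Set Implicit Arguments. Unset Strict Implicit. Unset Printing Implicit Defensive.
Import Order.TTheory GRing.Theory Num.Theory.
Local Open Scope ring_scope.

(** Reject the first two thirds of the nodes. At each later time [t] compute an
    optimal matching of the nodes seen so far, and call the arriving node
    tentative if that matching covers it, say by [r]; accept it if no earlier
    tentative node was assigned the same [r].

    Let [X_t] be the tentative nodes arriving from time [t] on. Marginal values
    are measured against the tentative nodes that arrive later, because given
    the set of the first [t + 1] nodes and the later arrivals, [X_(t+1)] is
    determined while the node at time [t] is still uniform in that set. Hence
    [(t + 1) E(f X_t - f X_(t+1)) >= E(f OPT_t) - E(f X_(t+1))] with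
    [E(f OPT_t) >= (t + 1) / n * f OPT], and summing over [t] gives
    [E(f X_0) >= f OPT / 6]. Given the future of time [u], at most one of the
    [u + 1] possible nodes at time [u] is assigned a prescribed [r], so a union
    bound shows that at least half of every expected marginal gain survives the
    collisions. The competitive ratio is therefore at most 12.

    Uniformity requires that ties between optimal matchings do not depend on
    the arrival order; a random relabelling of the arrival positions ensures
    this, and acceptance probabilities are obtained by conditioning this random
    relabelling on the past decisions. *)

(** * Inequalities for monotone submodular set functions *)

Lemma finset_ind (T : finType) (P : {set T} -> Prop) :
    P set0 -> (forall (S : {set T}) l, l \notin S -> P S -> P (l |: S)) ->
  forall S, P S.
Proof.
move=> P0 PU S; elim: {S}#|S| {-2}S (erefl #|S|) => [|k IH] S Sk.
  by move/eqP: Sk; rewrite cards_eq0 => /eqP ->.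
have /card_gt0P[l lS] : (0 < #|S|)%N by rewrite Sk.
rewrite -(setD1K lS); apply: PU; first by rewrite !inE eqxx.
by apply: IH; move: Sk; rewrite (cardsD1 l) lS => -[].
Qed.

Section Submodular.
Variables (R : realType) (n : nat) (f : {set 'I_n} -> R).
Hypotheses (f0 : set_nonneg f) (fmono : set_monotone f) (fsub : set_submodular f).

Lemma marginal_antitone (A B : {set 'I_n}) x :
  A \subset B -> f (x |: B) - f B <= f (x |: A) - f A.
Proof.
move=> sAB; have [xB|xB] := boolP (x \in B).
  have -> : x |: B = B by apply/setUidPr; rewrite sub1set.
  by rewrite subrr subr_ge0 fmono // subsetUr.
have := fsub (x |: A) B.
have -> : (x |: A) :|: B = x |: B by rewrite -setUA; congr (_ :|: _); apply/setUidPr.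
have -> : (x |: A) :&: B = A.
  apply/setP=> y; rewrite !inE; case: eqVneq => [->|_] /=.
    by rewrite (negbTE xB); apply/esym/negbTE; apply: contra xB; apply: (subsetP sAB).
  by apply: andb_idr; apply: (subsetP sAB).
lra.
Qed.

Lemma sum_marginals_ge (X S : {set 'I_n}) :
  f (S :|: X) - f X <= \sum_(l in S) (f (l |: X) - f X).
Proof.
elim/finset_ind: S => [|S l lS IH]; first by rewrite set0U big_set0 subrr.
rewrite big_setU1 //= -setUA.
have := marginal_antitone l (subsetUr S X); lra.
Qed.

(** Building [S] up one element at a time, each step gains at least the marginal of that element
    over [S :\ l], so these marginals sum to at most [f S - f set0]. The induction runs over subsets
    [A] while [S] stays fixed. *)
Lemma sum_remove_one_ge (S : {set 'I_n}) :
  f S *+ #|S|.-1 <= \sum_(l in S) f (S :\ l).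
Proof.
suff H : forall A : {set 'I_n}, A \subset S ->
    \sum_(l in A) (f S - f (S :\ l)) <= f A - f set0.
  have := H S (subxx _); rewrite sumrB sumr_const.
  case E : #|S| => [|k] /=.
    by move/eqP: E; rewrite cards_eq0 => /eqP ->; rewrite big_set0.
  by rewrite mulrS; have := f0 set0; lra.
move=> A; elim/finset_ind: A => [|A l lA IH] sAS; first by rewrite big_set0 subrr.
have [lS sA] : l \in S /\ A \subset S.
  by move: sAS; rewrite subUset sub1set => /andP[].
rewrite big_setU1 //=; have := IH sA.
have sAl : A \subset S :\ l by rewrite subsetD1 sA.
by have := marginal_antitone l sAl; rewrite setD1K //; lra.
Qed.
End Submodular.

(** * Matchings as partial functions, and optimal matchings on a subset *)

Section Matching.
Variables (R : realType) (n m : nat).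
Implicit Types (adj : 'I_n -> {set 'I_m}) (f : {set 'I_n} -> R).
Implicit Types (B : {set 'I_n}) (mu : {ffun 'I_n -> option 'I_m}).

(** A partial function lets the partner of an arriving node be read off directly; [indep_match] and
    [match_indep] translate from and to independence. *)
Definition match_on adj B mu : bool :=
  [forall l, forall r, (mu l == Some r) ==> (l \in B) && (r \in adj l)] &&
  [forall l, forall l', (mu l != None) && (mu l == mu l') ==> (l == l')].

Definition mdom mu : {set 'I_n} := [set l | mu l != None].

(** For a matching on [B] the intersection with [B] changes nothing. It makes the objective, as a
    function of every [mu], depend only on [f] below [B], whence [best_match_local]. *)
Definition best_match adj f B : {ffun 'I_n -> option 'I_m} :=
  [arg max_(mu > [ffun=> None] | match_on adj B mu) f (mdom mu :&: B)]%O.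

Lemma match_onP adj B mu :
  reflect ((forall l r, mu l = Some r -> (l \in B) /\ (r \in adj l)) /\
           (forall l l' r, mu l = Some r -> mu l' = Some r -> l = l'))
          (match_on adj B mu).
Proof.
apply: (iffP andP) => -[H1 H2]; split.
- move=> l r E; apply/andP; have /forallP/(_ l)/forallP/(_ r) := H1.
  by rewrite E eqxx.
- move=> l l' r E E'; have /forallP/(_ l)/forallP/(_ l') := H2.
  by rewrite E E' eqxx /= => /eqP.
- apply/forallP=> l; apply/forallP=> r; apply/implyP=> /eqP /H1 [-> ->] //.
- apply/forallP=> l; apply/forallP=> l'; apply/implyP=> /andP[].
  case E : (mu l) => [r|] // _ /eqP E'; apply/eqP; exact: (H2 _ _ r).
Qed.

Lemma match_on_none adj B : match_on adj B [ffun=> None].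
Proof. by apply/match_onP; split=> [l r|l l' r]; rewrite ffunE. Qed.

Lemma best_match_on adj f B : match_on adj B (best_match adj f B).
Proof. by rewrite /best_match; case: arg_maxP => //; apply: match_on_none. Qed.

Lemma mdom_sub adj B mu : match_on adj B mu -> mdom mu \subset B.
Proof.
move=> /match_onP[H _]; apply/subsetP=> l; rewrite inE.
by case E : (mu l) => [r|] // _; case: (H _ _ E).
Qed.

Lemma indep_match adj (T : {set 'I_n}) :
  transversal_indep adj T -> exists2 mu, match_on adj T mu & mdom mu = T.
Proof.
move=> /existsP[M /andP[/andP[/forallP H1 /forallP H2] /eqP defT]].
have inj e e' : e \in M -> e' \in M -> (e.1 == e'.1) || (e.2 == e'.2) -> e = e'.
  move=> eM e'M h; apply/eqP; have := H2 e; rewrite eM /= => /forallP/(_ e').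
  by rewrite e'M h.
pose mu := [ffun l => [pick r | (l, r) \in M]].
have muP l r : (mu l == Some r) = ((l, r) \in M).
  rewrite ffunE; case: pickP => [r' M'|/(_ r) -> //].
  apply/eqP/idP => [[<-] //|Mr]; congr Some.
  by have := inj _ _ Mr M'; rewrite /= eqxx => /(_ isT) [].
have muT : mdom mu = T.
  apply/setP=> l; rewrite inE defT; apply/idP/imsetP => [|[[l' r] lrM /= ->]].
    by case E : (mu l) => [r|] // _; exists (l, r); rewrite // -muP E.
  by move: lrM; rewrite -muP => /eqP ->.
exists mu => //; apply/match_onP; split=> [l r|l l' r] /eqP.
  move=> E; rewrite -muT inE (eqP E); split=> //.
  by have := H1 (l, r); rewrite -muP E.
rewrite muP => lM /eqP; rewrite muP => l'M.
by have := inj _ _ lM l'M; rewrite /= eqxx orbT => /(_ isT) [].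
Qed.

Lemma match_indep adj B mu (T : {set 'I_n}) : match_on adj B mu ->
  T \subset mdom mu -> transversal_indep adj T.
Proof.
move=> /match_onP[H1 H2] sT; apply/existsP.
exists [set e : 'I_n * 'I_m | (e.1 \in T) && (mu e.1 == Some e.2)]; apply/andP; split.
  apply/andP; split; apply/forallP=> -[l r]; apply/implyP; rewrite inE /= => /andP[lT /eqP E].
    by case: (H1 _ _ E).
  apply/forallP=> -[l' r']; apply/implyP; rewrite inE /= => /andP[l'T /eqP E'].
  apply/implyP=> /orP[] /eqP h; last first.
    by rewrite -h in E' *; rewrite (H2 _ _ _ E E').
  by rewrite h E' in E *; case: E => ->.
apply/eqP/setP=> l; apply/idP/imsetP => [lT|[[l' r]]]; last by rewrite inE => /andP[lT _] ->.
have := subsetP sT _ lT; rewrite inE; case E : (mu l) => [r|] // _.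
by exists (l, r); rewrite // inE /= lT E eqxx.
Qed.

(** A matching that covers [T], restricted to [B], competes in the maximum. *)
Lemma best_match_ge adj f B (T : {set 'I_n}) : set_monotone f ->
  transversal_indep adj T -> f (T :&: B) <= f (mdom (best_match adj f B)).
Proof.
move=> fm /indep_match[mu /match_onP[H1 H2] muT].
have := mdom_sub (best_match_on adj f B).
rewrite /best_match; case: arg_maxP => [|nu _ maxnu sB]; first exact: match_on_none.
pose mu' := [ffun l => if l \in B then mu l else None].
have /maxnu : match_on adj B mu'.
  apply/match_onP; split=> [l r|l l' r]; rewrite !ffunE; case: ifP => // lB.
    by move=> /H1[_ ->].
  by case: ifP => // _; apply: H2.
rewrite (setIidPl sB); apply: le_trans; apply: fm; apply/subsetP=> l.
by rewrite -muT !inE ffunE => /andP[lT lB]; rewrite lB lT.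
Qed.

Lemma best_match_local adj adj' f f' B :
    (forall l, l \in B -> adj l = adj' l) ->
    (forall S : {set 'I_n}, S \subset B -> f S = f' S) ->
  best_match adj f B = best_match adj' f' B.
Proof.
move=> eadj ef; rewrite /best_match; congr (Order.arg_max _ _ _).
  apply/funext=> mu; apply/match_onP/match_onP => -[H1 H2]; split=> // l r /H1[lB].
    by rewrite -eadj.
  by rewrite eadj.
by apply/funext=> mu; apply: ef; apply: subsetIr.
Qed.
End Matching.

(** * The selection rule under a random arrival order *)

(** Resampling: [tperm i u * tau] exchanges the nodes at times [i] and [u], and for each [i] this is
    a bijection of the arrival orders. The inner sum thus averages over which of the first [u.+1]
    arrivals comes at time [u]. *)
Lemma sum_perm_swap (R : realType) n (u : 'I_n) (F : 'S_n -> R) :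
  (\sum_tau F tau) *+ u.+1 =
  \sum_tau \sum_(i < n | (i <= u)%N) F (tperm i u * tau)%g.
Proof.
rewrite [RHS]exchange_big /= [RHS](eq_bigr (fun=> \sum_tau F tau)); last first.
  by move=> i _; rewrite [RHS](reindex_inj (mulgI (tperm i u))).
rewrite sumr_const; congr (_ *+ _).
by rewrite -sum1_card (big_ord_narrow (ltn_ord u)) sum1_card card_ord.
Qed.

Section Selection.
Variables (R : realType) (n m : nat).
Variables (adj : 'I_n -> {set 'I_m}) (f : {set 'I_n} -> R).
Implicit Types (tau : 'S_n) (t u i : 'I_n).

Definition sample_size (k : nat) : nat := (2 * k %/ 3)%N.

Definition seen tau (k : nat) : {set 'I_n} := tau @: [set i : 'I_n | (i < k)%N].

Definition tentative tau t : option 'I_m :=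
  if (sample_size n <= t)%N then best_match adj f (seen tau t.+1) (tau t) else None.

(** The first tentative node assigned [r] is always accepted, so this says that [r] is still free,
    without recursion on earlier acceptances. *)
Definition accept tau t : bool :=
  (tentative tau t != None) &&
  [forall u : 'I_n, (u < t)%N ==> (tentative tau u != tentative tau t)].

Definition candidates tau (k : nat) : {set 'I_n} :=
  tau @: [set u : 'I_n | (k <= u)%N && (tentative tau u != None)].

Definition selected tau (k : nat) : {set 'I_n} :=
  tau @: [set u : 'I_n | (k <= u)%N && accept tau u].

Definition clash tau u t : bool :=
  (tentative tau t != None) && (tentative tau u == tentative tau t).

Definition gain tau t : R := f (candidates tau t) - f (candidates tau t.+1).

Lemma mem_perm_imset tau (P : pred 'I_n) i : (tau i \in tau @: [set j | P j]) = P i.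
Proof. by rewrite (mem_imset _ _ perm_inj) inE. Qed.

Lemma imset_step tau t (P : pred 'I_n) :
  tau @: [set u : 'I_n | (t <= u)%N && P u] =
  if P t then tau t |: tau @: [set u : 'I_n | (t < u)%N && P u]
  else tau @: [set u : 'I_n | (t < u)%N && P u].
Proof.
apply/setP=> l; rewrite -(permKV tau l).
case: ifP => Pt; rewrite ?inE ?mem_perm_imset ?(inj_eq perm_inj) leq_eqVlt;
  rewrite (eq_sym (t : nat)) (inj_eq val_inj);
  by case: eqVneq => // ->; rewrite ?Pt ?andbF.
Qed.

(** The swap permutes the first [k] arrivals among themselves. The lemmas that follow deduce that
    everything after time [u] is unaffected by resampling time [u]. *)
Lemma seen_swap tau i u k : (i <= u)%N -> (u < k)%N ->
  seen (tperm i u * tau)%g k = seen tau k.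
Proof.
move=> iu uk; apply/setP=> l; rewrite -(permKV (tperm i u * tau)%g l).
rewrite mem_perm_imset permM mem_perm_imset.
by case: tpermP => [->|->|//]; apply/idP/idP => _; lia.
Qed.

Lemma swap_gt tau i u t : (i <= u)%N -> (u < t)%N -> (tperm i u * tau)%g t = tau t.
Proof.
move=> iu ut; rewrite permM tpermD //; apply/eqP=> E; move: iu ut; rewrite E; lia.
Qed.

Lemma tentative_swap tau i u t : (i <= u)%N -> (u < t)%N ->
  tentative (tperm i u * tau)%g t = tentative tau t.
Proof.
by move=> iu ut; rewrite /tentative (seen_swap _ iu) ?swap_gt // ltnW.
Qed.

Lemma tentative_swap_at tau i u : (i <= u)%N -> (sample_size n <= u)%N ->
  tentative (tperm i u * tau)%g u = best_match adj f (seen tau u.+1) (tau i).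
Proof. by move=> iu su; rewrite /tentative su (seen_swap _ iu) // permM tpermR. Qed.

Lemma candidates_swap tau i u k : (i <= u)%N -> (u < k)%N ->
  candidates (tperm i u * tau)%g k = candidates tau k.
Proof.
move=> iu uk; rewrite /candidates.
have -> : [set t : 'I_n | (k <= t)%N & tentative (tperm i u * tau)%g t != None] =
          [set t : 'I_n | (k <= t)%N & tentative tau t != None].
  apply/setP=> t; rewrite !inE; case: leqP => //= kt.
  by rewrite tentative_swap // (leq_trans uk).
apply: eq_in_imset => t; rewrite inE => /andP[kt _].
by rewrite swap_gt // (leq_trans uk).
Qed.

Lemma candidates_end tau : candidates tau n = set0.
Proof.
apply/setP=> l; rewrite -(permKV tau l) mem_perm_imset inE.
by rewrite leqNgt ltn_ord.
Qed.

Lemma selected_end tau : selected tau n = set0.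
Proof.
apply/setP=> l; rewrite -(permKV tau l) mem_perm_imset inE.
by rewrite leqNgt ltn_ord.
Qed.

Lemma selected_sub_candidates tau k : selected tau k \subset candidates tau k.
Proof. by apply: imsetS; apply/subsetP=> t; rewrite !inE => /andP[-> /andP[-> _]]. Qed.

Lemma candidates_anti tau k k' : (k <= k')%N -> candidates tau k' \subset candidates tau k.
Proof.
move=> kk'; apply: imsetS; apply/subsetP=> t; rewrite !inE => /andP[h ->].
by rewrite (leq_trans kk').
Qed.

Lemma tentative_adj tau t r : tentative tau t = Some r -> r \in adj (tau t).
Proof.
rewrite /tentative; case: ifP => // _.
by have /match_onP[H _] := best_match_on adj f (seen tau t.+1); move=> /H[].
Qed.

(** Accepted nodes keep their tentative partners: if two of them shared [r], neither could arrive
    before the other. *)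
Lemma selected_indep tau : transversal_indep adj (tau @: [set t | accept tau t]).
Proof.
pose mu := [ffun l => if accept tau (tau^-1%g l) then tentative tau (tau^-1%g l) else None].
apply: (@match_indep _ _ adj setT mu); last first.
  apply/subsetP=> l; rewrite -(permKV tau l) mem_perm_imset inE ffunE permK => al.
  by rewrite al; case/andP: al.
have noclash t u r : accept tau t -> tentative tau t = Some r ->
    tentative tau u = Some r -> (t <= u)%N.
  move=> /andP[_ /forallP/(_ u)] + Et Eu; rewrite Et Eu eqxx leqNgt.
  by case: ltnP.
apply/match_onP; split=> [l r|l l' r]; rewrite !ffunE; case: ifP => // al El.
  by split; rewrite ?inE //; move: (tentative_adj El); rewrite permKV.
case: ifP => // al' El'; apply: (@perm_inj _ tau^-1%g); apply/val_inj/eqP.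
by rewrite eqn_leq (noclash _ _ r al) // (noclash _ _ r al').
Qed.

(** * Gains and collisions, summed over all arrival orders *)

Hypotheses (f0 : set_nonneg f) (fmono : set_monotone f) (fsub : set_submodular f).

Lemma gain_ge0 tau t : 0 <= gain tau t.
Proof. by rewrite subr_ge0 fmono // candidates_anti. Qed.

Lemma gainE tau t : gain tau t =
  if tentative tau t != None
  then f (tau t |: candidates tau t.+1) - f (candidates tau t.+1) else 0.
Proof.
rewrite /gain {1}/candidates (imset_step tau t (fun u => tentative tau u != None)).
by case: ifP => // _; rewrite subrr.
Qed.

(* Conditioned on the set of the first [t + 1] arrivals and on everything that
   happens later, the node arriving at time [t] is uniform in that set. *)
Lemma sum_gain_ge (T : {set 'I_n}) t : transversal_indep adj T ->
    (sample_size n <= t)%N ->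
  \sum_tau (f (T :&: seen tau t.+1) - f (candidates tau t.+1)) <=
  (\sum_tau gain tau t) *+ t.+1.
Proof.
move=> indT st; rewrite sum_perm_swap; apply: ler_sum => tau _.
set X := candidates tau t.+1; set mu := best_match adj f (seen tau t.+1).
(* Resampling fixes [X] and [mu], and the resampled node is tentative exactly when [mu] covers it;
   [mu] covers no node arriving after [t]. *)
have -> : \sum_(i < n | (i <= t)%N) gain (tperm i t * tau)%g t =
          \sum_(l in mdom mu) (f (l |: X) - f X).
  rewrite [RHS](reindex_inj (@perm_inj _ tau)) /=.
  rewrite big_mkcond [RHS]big_mkcond /=; apply: eq_bigr => i _.
  case: ifP => it; last first.
    case: ifP => // /(subsetP (mdom_sub (best_match_on _ _ _))).
    by rewrite mem_perm_imset ltnS it.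
  by rewrite gainE tentative_swap_at // candidates_swap // permM tpermR inE.
apply: le_trans (sum_marginals_ge fmono fsub X (mdom mu)); apply: lerB => //.
apply: le_trans (fmono (subsetUl _ _)); exact: best_match_ge.
Qed.

(** Resampling time [u] leaves [gain tau t] and the partner [r] at time [t] fixed, and a single
    matching on the first [u.+1] arrivals gives [r] to at most one of them. *)
Lemma sum_clash_le u t : (u < t)%N ->
  (\sum_tau (if clash tau u t then gain tau t else 0)) *+ u.+1 <= \sum_tau gain tau t.
Proof.
move=> ut; rewrite sum_perm_swap; apply: ler_sum => tau _.
rewrite (eq_bigr (fun i => if clash (tperm i u * tau)%g u t then gain tau t else 0)); last first.
  by move=> i iu; rewrite /gain !candidates_swap // ltnW.
rewrite -big_mkcondr sumr_const; set A := (X in #|X|).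
suff : (#|A| <= 1)%N.
  by case: #|A| => [|[]] // _; rewrite ?mulr0n ?gain_ge0.
apply/card_le1_eqP => i j; rewrite !unfold_in => /andP[iu ci] /andP[ju cj].
move: ci cj; rewrite /clash (tentative_swap _ iu ut) (tentative_swap _ ju ut).
case: (leqP (sample_size n) u) => su; last first.
  rewrite /tentative [(sample_size n <= u)%N]leqNgt su /=.
  by case: (if _ then _ else _).
rewrite !tentative_swap_at //.
case: (tentative tau t) => [r|] // /eqP Ei /eqP Ej.
have /match_onP[_ H] := best_match_on adj f (seen tau u.+1).
by apply: (@perm_inj _ tau); apply: (H _ _ r).
Qed.

(** The first [k] arrivals are the first [k.+1] minus a uniform one of them, so [sum_remove_one_ge]
    for [S] mapped to [f (T :&: S)] applies. *)
Lemma sum_inter_seen_step (T : {set 'I_n}) k : (k < n)%N ->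
  (\sum_tau f (T :&: seen tau k.+1)) *+ k <= (\sum_tau f (T :&: seen tau k)) *+ k.+1.
Proof.
move=> kn; have [u ->] : exists u : 'I_n, k = u by exists (Ordinal kn).
rewrite sum_perm_swap -sumrMnl; apply: ler_sum => tau _.
pose g (S : {set 'I_n}) := f (T :&: S).
have := @sum_remove_one_ge _ _ g _ _ _ (seen tau u.+1).
have -> : #|seen tau u.+1| = u.+1.
  rewrite card_imset; last exact: perm_inj.
  by rewrite cardsE -sum1_card (big_ord_narrow (ltn_ord u)) sum1_card card_ord.
rewrite /g /= => H; apply: (le_trans (H _ _ _)).
- by move=> S.
- by move=> S S' sS; apply: fmono; apply: setIS.
- move=> S S'; rewrite setIUr; apply: le_trans (fsub _ _).
  by rewrite setIACA setIid.
rewrite le_eqVlt; apply/orP; left; apply/eqP.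
rewrite (reindex_inj (@perm_inj _ tau)) /=.
apply: eq_big => i; rewrite mem_perm_imset // ltnS => iu.
congr (f (_ :&: _)); apply/setP=> l; rewrite -(permKV (tperm i u * tau)%g l).
rewrite mem_perm_imset !inE permM mem_perm_imset (inj_eq perm_inj).
move: ((tperm i u * tau)^-1%g l) => j; case: tpermP => [->|->|ji ju].
- by rewrite -(inj_eq val_inj) /=; lia.
- by rewrite eqxx ltnn.
by rewrite -(inj_eq val_inj) /=; move/eqP: ji; move/eqP: ju; rewrite -!(inj_eq val_inj) /=; lia.
Qed.

(** Downward induction from [k = n], where all of [T] has been seen; the factors [k / k.+1] multiply
    to [k / n]. *)
Lemma sum_inter_seen_ge (T : {set 'I_n}) k : (k <= n)%N ->
  (\sum_(tau : 'S_n) f T) *+ k <= (\sum_tau f (T :&: seen tau k)) *+ n.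
Proof.
move=> kn; have [j def_n] : exists j, n = (k + j)%N by exists (n - k)%N; rewrite subnKC.
elim: j k kn def_n => [|j IH] k kn def_n.
  have -> : k = n by rewrite def_n addn0.
  rewrite le_eqVlt; apply/orP; left; apply/eqP; congr (_ *+ _).
  apply: eq_bigr => tau _; congr f; apply/esym/setIidPl/subsetP=> l _.
  by rewrite -(permKV tau l) mem_perm_imset.
have kn' : (k < n)%N by rewrite def_n; lia.
have := IH k.+1 kn'; rewrite addSnnS => /(_ def_n).
have := sum_inter_seen_step T kn'.
set a := \sum_tau _; set b := \sum_tau _; set c := \sum_(tau : 'S_n) f T => ab ca.
rewrite -(ler_pMn2r (ltn0Sn k)) mulrnAC.
apply: (@le_trans _ _ (a *+ n *+ k)); first by rewrite lerMn2r ca orbT.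
by rewrite mulrnAC [leRHS]mulrnAC lerMn2r ab orbT.
Qed.

(** Telescope [f] along [selected]. An accepted node gains at least [gain tau t], since [selected]
    lies inside [candidates] and marginals are antitone; a rejected tentative node has a clash,
    whose term cancels its gain. *)
Lemma selected_value_ge tau :
  f set0 + \sum_(t < n) (gain tau t -
    \sum_(u < n | (u < t)%N) (if clash tau u t then gain tau t else 0)) <=
  f (selected tau 0).
Proof.
have <- : f set0 + \sum_(t < n) (f (selected tau t) - f (selected tau t.+1)) =
          f (selected tau 0).
  rewrite (eq_bigr (fun t : 'I_n => - f (selected tau t.+1) - (- f (selected tau t))));
    last by move=> t _; rewrite opprK addrC.
  rewrite -(big_mkord xpredT (fun k => - f (selected tau k.+1) - (- f (selected tau k)))).
  by rewrite telescope_sumr // selected_end opprK addrA subrr add0r.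
rewrite lerD2l; apply: ler_sum => t _.
have clash_ge0 : 0 <= \sum_(u < n | (u < t)%N) (if clash tau u t then gain tau t else 0).
  by apply: sumr_ge0 => u _; case: ifP => // _; apply: gain_ge0.
rewrite [X in _ <= f X - _](imset_step tau t (accept tau)) -/(selected tau t.+1).
case: ifP => [/andP[tent _]|/negbT].
  have := marginal_antitone fmono fsub (tau t) (selected_sub_candidates tau t.+1).
  have := gainE tau t; rewrite tent; move: clash_ge0; lra.
rewrite negb_and negbK subrr => /orP[/eqP tentN|].
  by have := gainE tau t; rewrite tentN eqxx /=; move: clash_ge0; lra.
rewrite negb_forall => /existsP[u]; rewrite negb_imply negbK => /andP[ut c].
case: (eqVneq (tentative tau t) None) => [tentN|tent].
  by have := gainE tau t; rewrite tentN eqxx /=; move: clash_ge0; lra.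
rewrite (bigD1 u) //= /clash tent c /= opprD addrA subrr add0r oppr_le0.
by apply: sumr_ge0 => v _; case: ifP => // _; apply: gain_ge0.
Qed.

Lemma sum_clashes_le t :
  (\sum_(u < n | (u < t)%N) \sum_tau (if clash tau u t then gain tau t else 0)) *+ 2 <=
  \sum_tau gain tau t.
Proof.
set s := sample_size n; set G := \sum_tau gain tau t.
have G0 : 0 <= G by apply: sumr_ge0 => tau _; apply: gain_ge0.
(* At most [n - 1 - s] times [u] precede [t] after the sample, each costing at most [G / s.+1]. A
   sample of two thirds makes the total at most [G / 2]. *)
have ns : (2 * (n - 1 - s) <= s.+1)%N by rewrite /s /sample_size; lia.
have s0 : 0 < s.+1%:R :> R by rewrite ltr0n.
apply: (@le_trans _ _ ((\sum_(u < n | (u < t)%N && (s <= u)%N) G / s.+1%:R) *+ 2)).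
  rewrite lerMn2r /= [leRHS]big_mkcondr /=; apply: ler_sum => u ut.
  case: leqP => su.
    rewrite ler_pdivlMr //; apply: le_trans (sum_clash_le ut).
    rewrite mulr_natr; apply: ler_wpMn2l; rewrite ?ltnS //.
    by apply: sumr_ge0 => tau _; case: ifP => // _; apply: gain_ge0.
  have tentN tau : tentative tau u = None by rewrite /tentative -/s leqNgt su.
  by rewrite big1 // => tau _; rewrite /clash tentN; case: (tentative tau t).
rewrite sumr_const.
have -> : #|[pred u : 'I_n | (u < t)%N && (s <= u)%N]| = (t - s)%N.
  rewrite -sum1_card -(big_geq_mkord _ _ (fun k => (k < t)%N) (fun=> 1%N)).
  by rewrite -(big_nat_widen s t n xpredT) ?sum_nat_const_nat ?muln1 // ltnW.
rewrite -mulrnA -[leLHS]mulr_natr mulrAC ler_pdivrMr //.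
rewrite ler_wpM2l // ler_nat; have := ltn_ord t; lia.
Qed.

Lemma sum_selected_value (T : {set 'I_n}) : transversal_indep adj T ->
  \sum_(tau : 'S_n) f T <= (\sum_tau f (selected tau 0)) *+ 12.
Proof.
move=> indT; set s := sample_size n.
(* The empty ground set is separated because the averages below divide by [n]. *)
case: (posnP n) => [n0|n0].
  rewrite -sumrMnl; apply: ler_sum => tau _.
  have -> : selected tau 0 = T by apply/setP=> l; move: (ltn_ord l); rewrite {2}n0.
  by have := f0 T; lra.
set O := \sum_(tau : 'S_n) f T.
set ALG := \sum_tau _.
pose H k := \sum_tau f (candidates tau k).
pose G t := \sum_tau gain tau t.
have HG t : G t = H t - H t.+1 by rewrite /G sumrB.
have H0 k : 0 <= H k by apply: sumr_ge0.
have Hle k : H k <= H 0%N.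
  by apply: ler_sum => tau _; apply: fmono; apply: candidates_anti.
have G0 t : 0 <= G t by apply: sumr_ge0 => tau _; apply: gain_ge0.
have sumG : \sum_t G t = H 0%N - H n.
  rewrite (eq_bigr (fun t : 'I_n => - H t.+1 - (- H t))); last first.
    by move=> t _; rewrite HG opprK addrC.
  by rewrite -(big_mkord xpredT (fun k => - H k.+1 - (- H k))) telescope_sumr // opprK addrC.
have HnE : H n = \sum_(tau : 'S_n) f set0.
  by apply: eq_bigr => tau _; rewrite candidates_end.
(* The gains sum to [H 0 - H n] and clashes destroy at most half of that, while [H n], the share of
   [f set0], is kept in full. *)
have ALG_ge : H 0%N <= ALG *+ 2.
  have : H n + \sum_t (G t - \sum_(u < n | (u < t)%N)
            \sum_tau (if clash tau u t then gain tau t else 0)) <= ALG.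
    apply: le_trans (ler_sum _ (fun tau _ => selected_value_ge tau)).
    rewrite [leRHS]big_split /= -HnE lerD2l [leRHS]exchange_big /=; apply: ler_sum => t _.
    by rewrite sumrB [X in _ - X <= _]exchange_big.
  rewrite sumrB sumG.
  have : (\sum_(t < n) \sum_(u < n | (u < t)%N)
            \sum_tau (if clash tau u t then gain tau t else 0)) *+ 2 <= \sum_t G t.
    by rewrite -sumrMnl; apply: ler_sum => t _; apply: sum_clashes_le.
  by rewrite sumG; have := H0 n; lra.
have nR : 0 < n%:R :> R by rewrite ltr0n.
have sR : 0 < s.+1%:R :> R by rewrite ltr0n.
(* Weakening [H t.+1] to [H 0] and [t.+1] to [s.+1] makes the bound independent of [t], so it can be
   summed over the [n - s] times after the sample. *)
have Gge (t : 'I_n) : (s <= t)%N -> O / n%:R - H 0%N / s.+1%:R <= G t.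
  move=> st; have tR : 0 < t.+1%:R :> R by rewrite ltr0n.
  apply: (@le_trans _ _ (O / n%:R - H 0%N / t.+1%:R)).
    by rewrite lerB // ler_wpM2l // lef_pV2 ?posrE // ler_nat.
  have := sum_gain_ge indT st; rewrite sumrB -/(H t.+1) -/(G t) => aG.
  have := sum_inter_seen_ge T (ltn_ord t); rewrite -/O => aO.
  set a := \sum_tau _ in aG aO.
  have {}aO : O / n%:R * t.+1%:R <= a by rewrite mulrAC ler_pdivrMr // !mulr_natr.
  rewrite -(ler_pM2r tR) mulrBl divfK ?gt_eqF //.
  rewrite [leRHS]mulr_natr; have := Hle t.+1; lra.
have : \sum_(t < n | (s <= t)%N) (O / n%:R - H 0%N / s.+1%:R) <= H 0%N - H n.
  rewrite -sumG [leLHS]big_mkcond; apply: ler_sum => t _.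
  by case: ifP => // /Gge.
rewrite sumr_const.
have -> : #|[pred t : 'I_n | (s <= t)%N]| = (n - s)%N.
  by rewrite -sum1_card -(big_geq_mkord _ _ xpredT (fun=> 1%N)) sum_nat_const_nat muln1.
rewrite mulrnBl.
(* From [n <= 3 * (n - s)] and [n - s <= s.+1] the summed bound becomes [O / 3 - H 0 <= H 0 - H n].
   Hence [O <= 6 * H 0], and [ALG_ge] doubles the constant to 12. *)
have : O / 3%:R <= O / n%:R *+ (n - s).
  rewrite -[leRHS]mulr_natr -mulrA ler_wpM2l ?sumr_ge0 //.
  rewrite mulrC ler_pdivlMr // mulrC ler_pdivrMr // -natrM ler_nat /s /sample_size; lia.
have : H 0%N / s.+1%:R *+ (n - s) <= H 0%N.
  rewrite -[leLHS]mulr_natr -mulrA ler_piMr // mulrC ler_pdivrMr // mul1r ler_nat /s /sample_size; lia.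
move: (_ *+ (n - s)) (_ *+ (n - s)) (H0 n) => x y; lra.
Qed.
End Selection.

(** * Decisions as functions of the information revealed so far *)

Section Behavioural.
Variables (R : realType) (n m : nat).
Implicit Types (adj : 'I_n -> {set 'I_m}) (f : {set 'I_n} -> R) (tau : 'S_n).

Lemma tentative_local adj adj' f f' tau (t u : 'I_n) : (u <= t)%N ->
    (forall l, l \in seen tau t.+1 -> adj l = adj' l) ->
    (forall S : {set 'I_n}, S \subset seen tau t.+1 -> f S = f' S) ->
  tentative adj f tau u = tentative adj' f' tau u.
Proof.
move=> ut eadj ef; rewrite /tentative; case: ifP => // _.
have sub : seen tau u.+1 \subset seen tau t.+1.
  apply: imsetS; apply/subsetP=> j; rewrite !inE !ltnS => ju; exact: leq_trans ut.
congr fun_of_fin; apply: best_match_local => [l /(subsetP sub)/eadj //|S sS].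
by apply: ef; apply: subset_trans sub.
Qed.

Lemma accept_local adj adj' f f' tau (t : 'I_n) :
    (forall l, l \in seen tau t.+1 -> adj l = adj' l) ->
    (forall S : {set 'I_n}, S \subset seen tau t.+1 -> f S = f' S) ->
  accept adj f tau t = accept adj' f' tau t.
Proof.
move=> eadj ef; rewrite /accept (tentative_local (leqnn t) eadj ef).
congr (_ && _); apply: eq_forallb => u; case: ltnP => //= ut.
by rewrite (tentative_local (ltnW ut) eadj ef).
Qed.

(* The arrival positions are renamed by random labels [tau], so that ties
   between optimal matchings are broken independently of the arrival order. *)
Definition decide adj f tau (t : 'I_n) : bool :=
  accept (fun l => adj (tau^-1%g l)) (fun S => f (tau^-1%g @: S)) tau t.

(** This is what makes the rule online: the decision at [t] depends only on edges and values at
    positions up to [t]. *)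
Lemma decide_local adj adj' f f' tau (t : 'I_n) :
    (forall j : 'I_n, (j <= t)%N -> adj j = adj' j) ->
    (forall S : {set 'I_n}, {in S, forall j : 'I_n, (j <= t)%N} -> f S = f' S) ->
  decide adj f tau t = decide adj' f' tau t.
Proof.
move=> eadj ef.
have pos l : l \in seen tau t.+1 -> (tau^-1%g l <= t)%N.
  by rewrite -{1}(permKV tau l) mem_perm_imset ltnS.
apply: accept_local => [l /pos/eadj //|S /subsetP sS].
by apply: ef => j /imsetP[l /sS /pos lt ->].
Qed.

(** Pads the revealed data to a full instance on ['I_n], with [set0] for nodes still to come; by
    [decide_local], decisions up to [t] agree with those on the true instance. *)
Definition position_adj t (a : 'I_t.+1 -> {set 'I_m}) (j : 'I_n) : {set 'I_m} :=
  if insub (j : nat) is Some i then a i else set0.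

Definition position_value t (g : {set 'I_t.+1} -> R) (S : {set 'I_n}) : R :=
  g [set i : 'I_t.+1 | [exists j in S, (j : nat) == i]].

Lemma position_adjE adj (sigma : 'S_n) (t j : 'I_n) : (j <= t)%N ->
  position_adj (fun i => adj (@arrived n sigma t i)) j = adj (sigma j).
Proof.
move=> jt; rewrite /position_adj; case: insubP => [i _ ij|]; last by rewrite ltnS jt.
by congr (adj (sigma _)); apply: val_inj.
Qed.

Lemma position_valueE f (sigma : 'S_n) (t : 'I_n) (S : {set 'I_n}) :
    {in S, forall j : 'I_n, (j <= t)%N} ->
  position_value (fun U => f (@arrived n sigma t @: U)) S = f (sigma @: S).
Proof.
move=> St; congr f; apply/setP=> l; apply/imsetP/imsetP => -[i].
  rewrite inE => /existsP[j /andP[jS /eqP ji]] ->; exists j => //.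
  by congr (sigma _); apply: val_inj.
move=> iS ->; have it : (i < t.+1)%N by rewrite ltnS St.
exists (Ordinal it); first by rewrite inE; apply/existsP; exists i; rewrite iS /=.
by congr (sigma _); apply: val_inj.
Qed.
End Behavioural.

(** The label [tau] cannot be stored between steps, so it is replaced by its posterior, uniform on
    the set [C] of labels that reproduce the past decisions. An empty [C] gives [0 / 0 = 0]. The
    type allows [t >= n], where the existential fails and the probability is 0. *)
Definition secretary (R : realType) : online_alg R := fun n m t a g d =>
  let D := decide (@position_adj n m t a) (@position_value R n t g) in
  let C := [set tau : 'S_n |
    [forall u : 'I_t, forall j : 'I_n, ((j : nat) == u) ==> (D tau j == d u)]] in
  #|[set tau in C | [exists j : 'I_n, ((j : nat) == t) && D tau j]]|%:R / #|C|%:R.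

Lemma secretary_valid (R : realType) : valid_alg (@secretary R).
Proof.
move=> n m t a g d; rewrite /secretary /=; set C := (X in _ / #|pred_of_set X|%:R); set E := finset _.
have EC : (#|E| <= #|C|)%N.
  by apply/subset_leq_card/subsetP=> tau; rewrite in_set => /andP[].
rewrite divr_ge0 //=; case: (posnP #|C|) => [->|C0]; first by rewrite invr0 mulr0.
by rewrite ler_pdivrMr ?ltr0n // mul1r ler_nat.
Qed.

(** * From acceptance probabilities to an average over labels and orders *)

Section Run.
Variables (R : realType) (n m : nat).
Variables (adj : 'I_n -> {set 'I_m}) (f : {set 'I_n} -> R).
Implicit Types (sigma tau : 'S_n) (d : {ffun 'I_n -> bool}).

Definition run_decide sigma tau : 'I_n -> bool :=
  decide (fun j => adj (sigma j)) (fun S => f (sigma @: S)) tau.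

Definition consistent sigma d (k : nat) : {set 'S_n} :=
  [set tau | [forall j : 'I_n, (j < k)%N ==> (run_decide sigma tau j == d j)]].

Lemma consistentS sigma d (t : 'I_n) : consistent sigma d t.+1 =
  [set tau in consistent sigma d t | run_decide sigma tau t == d t].
Proof.
apply/setP=> tau; rewrite !inE; apply/forallP/andP => [H|[/forallP H /eqP Ht] j].
  split; last by have := H t; rewrite ltnSn.
  apply/forallP=> j; apply/implyP=> jt; have := H j.
  by rewrite ltnS (ltnW jt).
apply/implyP; rewrite ltnS leq_eqVlt => /orP[/eqP/val_inj -> | jt]; first by rewrite Ht.
by have := H j; rewrite jt.
Qed.

Lemma accept_prob_secretary sigma d t :
  accept_prob (@secretary R) adj f sigma d t =
  #|[set tau in consistent sigma d t | run_decide sigma tau t]|%:R /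
  #|consistent sigma d t|%:R.
Proof.
rewrite /accept_prob /secretary.
set D := decide _ _.
have DE tau (j : 'I_n) : (j <= t)%N -> D tau j = run_decide sigma tau j.
  move=> jt; apply: decide_local => [i ij|S Sj].
    by apply: position_adjE; apply: leq_trans jt.
  by apply: position_valueE => i /Sj ij; apply: leq_trans jt.
have -> : [set tau | [forall u : 'I_t, forall j : 'I_n,
      ((j : nat) == u) ==> (D tau j == past d u)]] = consistent sigma d t.
  apply/setP=> tau; rewrite !inE; apply/forallP/forallP => [H j|H u].
    apply/implyP=> jt; have /forallP/(_ j) := H (Ordinal jt).
    rewrite eqxx DE 1?ltnW //= => /eqP ->.
    by apply/eqP; congr (d _); apply: val_inj.
  apply/forallP=> j; apply/implyP=> /eqP ju.
  have jt : (j < t)%N by rewrite ju.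
  have := H j; rewrite jt /= DE 1?ltnW // => /eqP ->.
  by apply/eqP; congr (d _); apply: val_inj.
congr (_ %:R / _); congr (#|pred_of_set _|); apply/setP=> tau; rewrite !inE; congr (_ && _).
apply/existsP/idP => [[j /andP[/eqP/val_inj -> ]]|Dt]; first by rewrite DE.
by exists t; rewrite eqxx DE.
Qed.

(** Chain rule: the conditional probabilities telescope, each factor turning the number of labels
    consistent up to [t] into the number consistent up to [t.+1]. *)
Lemma run_prob_secretary sigma d : run_prob (@secretary R) adj f sigma d =
  #|[set tau | finfun (run_decide sigma tau) == d]|%:R / n`!%:R.
Proof.
pose q (t : 'I_n) := if d t then accept_prob (@secretary R) adj f sigma d t
                     else 1 - accept_prob (@secretary R) adj f sigma d t.
have step (t : 'I_n) :
    #|consistent sigma d t|%:R * q t = #|consistent sigma d t.+1|%:R.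
  rewrite /q accept_prob_secretary consistentS; set C := consistent _ _ _.
  set E := [set tau in C | run_decide sigma tau t].
  set E' := [set tau in C | _ == _].
  case: (posnP #|C|) => [C0|C0].
    have -> : E' = set0.
      by apply/setP=> tau; rewrite in_set (cards0_eq C0) !in_set0.
    by rewrite C0 mul0r cards0.
  have CR : #|C|%:R != 0 :> R by rewrite pnatr_eq0 -lt0n.
  case dt : (d t).
    rewrite mulrC divfK //; congr (#|pred_of_set _|%:R); apply/setP=> tau; rewrite !inE dt.
    by rewrite eqb_id.
  rewrite mulrBr mulr1 mulrC divfK //.
  have -> : #|C| = (#|E| + #|E'|)%N.
    rewrite -(cardsID [set tau | run_decide sigma tau t] C); congr (_ + _)%N.
      by apply: eq_card => tau; rewrite !inE.
    by apply: eq_card => tau; rewrite !inE dt andbC eqbF_neg.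
  by rewrite natrD addrC addKr.
have prefix k : (k <= n)%N -> \prod_(t < n | (t < k)%N) q t =
    #|consistent sigma d k|%:R / n`!%:R.
  elim: k => [_|k IH kn].
    rewrite big_pred0 //; have -> : consistent sigma d 0 = setT.
      by apply/setP=> tau; rewrite !inE; apply/forallP.
    rewrite cardsT card_Sn divff // pnatr_eq0 -lt0n; exact: fact_gt0.
  rewrite (bigD1 (Ordinal kn)) //= -(step (Ordinal kn)) /= mulrAC -IH 1?ltnW // mulrC.
  congr (_ * _); apply: eq_bigl => t; rewrite -(inj_eq val_inj) /=; lia.
rewrite /run_prob -/q; under eq_bigl => t do rewrite -(ltn_ord t).
rewrite prefix //; congr (_%:R / _); apply: eq_card => tau; rewrite !inE.
apply/forallP/eqP => [H|<- j]; last by rewrite ffunE eqxx implybT.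
by apply/ffunP=> j; rewrite ffunE; apply/eqP; have := H j; rewrite ltn_ord.
Qed.

(** Writing the order as [tau * pi] turns the run into the selection rule with arrival order [tau]
    on the instance relabelled by [pi], which does not involve [tau]. *)
Lemma run_decideE pi tau t :
  run_decide (tau * pi)%g tau t =
  accept (fun l => adj (pi l)) (fun S => f (pi @: S)) tau t.
Proof.
rewrite /run_decide /decide; congr (accept _ _ tau t); apply/funext => x.
  by rewrite permM permKV.
by rewrite -imset_comp; congr f; apply: eq_imset => l /=; rewrite permM permKV.
Qed.

Lemma accepted_run_decide pi tau :
  (tau * pi)%g @: [set t | run_decide (tau * pi)%g tau t] =
  pi @: selected (fun l => adj (pi l)) (fun S => f (pi @: S)) tau 0.
Proof.
rewrite /selected -imset_comp.
have -> : [set t | run_decide (tau * pi)%g tau t] =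
   [set u : 'I_n | (0 <= u)%N & accept (fun l => adj (pi l)) (fun S => f (pi @: S)) tau u].
  by apply/setP=> t; rewrite !inE run_decideE.
by apply: eq_imset => t; rewrite permM.
Qed.

Lemma accepted_finfun sigma (D : 'I_n -> bool) :
  accepted sigma (finfun D) = sigma @: [set t | D t].
Proof.
rewrite /accepted; have -> // : [set t | finfun D t] = [set t | D t].
by apply/setP=> t; rewrite !inE ffunE.
Qed.

(** For each fixed [tau], substituting [sigma = tau * pi] is a bijection, so [pi] and [tau] become
    independent and uniform. *)
Lemma expected_value_secretary : expected_value (@secretary R) adj f =
  (n`!%:R ^+ 2)^-1 * \sum_(pi : 'S_n) \sum_(tau : 'S_n)
    f (pi @: selected (fun l => adj (pi l)) (fun S => f (pi @: S)) tau 0).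
Proof.
rewrite /expected_value expr2 invfM -mulrA; congr (_ * _).
transitivity (n`!%:R^-1 * \sum_(sigma : 'S_n) \sum_(tau : 'S_n)
     f (sigma @: [set t | run_decide sigma tau t])).
  rewrite mulr_sumr; apply: eq_bigr => sigma _.
  rewrite mulr_sumr [RHS](partition_big (fun tau => finfun (run_decide sigma tau)) xpredT) //=.
  apply: eq_bigr => d _; rewrite run_prob_secretary.
  rewrite (eq_bigr (fun=> n`!%:R^-1 * f (accepted sigma d))).
    by rewrite sumr_const -[RHS]mulr_natl mulrA cardsE.
  by move=> tau /eqP <-; rewrite accepted_finfun.
congr (_ * _); rewrite exchange_big [RHS]exchange_big /=; apply: eq_bigr => tau _.
rewrite (reindex_inj (mulgI tau)) /=; apply: eq_bigr => pi _.
by rewrite accepted_run_decide.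
Qed.

Lemma indep_relabel (pi : 'S_n) (T : {set 'I_n}) :
  transversal_indep (fun l => adj (pi l)) T = transversal_indep adj (pi @: T).
Proof.
apply/idP/idP => /indep_match[mu /match_onP[H1 H2] muT].
  apply: (@match_indep _ _ adj setT [ffun l => mu (pi^-1%g l)]).
    apply/match_onP; split=> [l r|l l' r]; rewrite !ffunE.
      by move=> /H1[_]; rewrite permKV inE.
    by move=> h /(H2 _ _ _ h) /perm_inj.
  by rewrite -muT; apply/subsetP=> _ /imsetP[l + ->]; rewrite !inE ffunE permK.
apply: (@match_indep _ _ _ setT [ffun l => mu (pi l)]).
  apply/match_onP; split=> [l r|l l' r]; rewrite !ffunE.
    by move=> /H1[_]; rewrite inE.
  by move=> h /(H2 _ _ _ h) /perm_inj.
by apply/subsetP=> l lT; rewrite inE ffunE; have := imset_f pi lT; rewrite -muT inE.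
Qed.

(** A decision vector of nonzero probability is realised by some label [tau], and [selected_indep]
    covers that run. *)
Lemma secretary_indep sigma d : run_prob (@secretary R) adj f sigma d != 0 ->
  transversal_indep adj (accepted sigma d).
Proof.
rewrite run_prob_secretary mulf_eq0 negb_or pnatr_eq0 -lt0n => /andP[/card_gt0P[tau]].
rewrite inE => /eqP <- _; pose pi := (tau^-1 * sigma)%g.
have -> : sigma = (tau * pi)%g by rewrite mulKVg.
rewrite accepted_finfun accepted_run_decide -indep_relabel.
exact: selected_indep.
Qed.

Lemma expected_value_ge (T : {set 'I_n}) :
    set_nonneg f -> set_monotone f -> set_submodular f ->
    transversal_indep adj T ->
  f T <= expected_value (@secretary R) adj f *+ 12.
Proof.
move=> f0 fm fs indT; rewrite expected_value_secretary.
have N0 : 0 < n`!%:R :> R by rewrite ltr0n fact_gt0.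
rewrite -mulrnAr mulrC ler_pdivlMr ?exprn_gt0 //.
have -> : f T * n`!%:R ^+ 2 = \sum_(pi : 'S_n) \sum_(tau : 'S_n) f T.
  by rewrite !sumr_const card_Sn expr2 mulrA !mulr_natr.
rewrite -sumrMnl; apply: ler_sum => pi _.
pose g (S : {set 'I_n}) := f (pi @: S).
have piK : pi @: (pi^-1%g @: T) = T.
  by rewrite -imset_comp -[RHS]imset_id; apply: eq_imset => l /=; rewrite permKV.
have := @sum_selected_value R n m (fun l => adj (pi l)) g _ _ _ (pi^-1%g @: T).
rewrite /g piK; apply => //.
- by move=> S S' sS; apply/fm/imsetS.
- by move=> S S'; rewrite imsetU imsetI //; move=> ? ? _ _; apply: perm_inj.
by rewrite indep_relabel piK.
Qed.
End Run.

Theorem theorem4 (R : realType) :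
  exists A : online_alg R, valid_alg A /\
    forall (n m : nat) (adj : 'I_n -> {set 'I_m}) (f : {set 'I_n} -> R),
      set_nonneg f -> set_monotone f -> set_submodular f ->
      (forall (sigma : 'S_n) (d : {ffun 'I_n -> bool}),
          run_prob A adj f sigma d != 0 ->
          transversal_indep adj (accepted sigma d)) /\
      opt_value adj f / 95%:R <= expected_value A adj f.
Proof.
exists (@secretary R); split; first exact: secretary_valid.
move=> n m adj f f0 fm fs; split=> [sigma d|]; first exact: secretary_indep.
(* The bound for the empty set shows that the expected value is nonnegative, which handles the
   default 0 of the maximum and the slack between 12 and 95. *)
have indep0 : transversal_indep adj set0.
  by apply: (match_indep (match_on_none adj setT)); apply: sub0set.
have E0 : 0 <= expected_value (@secretary R) adj f.
  have := expected_value_ge f0 fm fs indep0; have := f0 set0; lra.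
rewrite ler_pdivrMr ?ltr0n //.
apply: (big_ind (fun x => x <= _)); first by rewrite mulr_ge0.
  by move=> x y hx hy; rewrite ge_max hx hy.
by move=> T /(expected_value_ge f0 fm fs); lra.
Qed.
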